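(* Let $X$ be a Banach space with $\dim X\ge 2$, and consider the following conditions: (i) $G_L(X)<8$; (ii) $H(X)<2$; (iii) $X$ is uniformly non-square. Then (i) implies (ii), and (ii) implies (iii).
   Context: $S_X=\{x\in X:\|x\|=1\}$ denotes the unit sphere of $X$. For a Banach space $X$ with $\dim X\ge 2$, define $$H(X)=\sup\{\min\{\|x+y\|,\|2x-y\|\}: x,\,y,\,x-y\in S_X\},$$ $$G_L(X)=\sup\{\|x+y\|^{2}+\|2x-y\|^{2}: x,y\in X,\ \|x\|=\|y\|=\|x-y\|=1\}.$$ $X$ is uniformly non-square (in the sense of James) if there exists $\delta\in(0,1)$ such that for all $x,y\in S_X$, either $\|x+y\|/2\le 1-\delta$ or $\|x-y\|/2\le 1-\delta$. *)

(* Defs.v *)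
From HB Require Import structures.
From mathcomp Require Import all_boot all_order all_algebra.
From mathcomp Require Import all_classical all_reals all_analysis.

Set Implicit Arguments.
Unset Strict Implicit.
Unset Printing Implicit Defensive.

Import Order.TTheory GRing.Theory Num.Theory.
Import numFieldNormedType.Exports.

Local Open Scope classical_set_scope.
Local Open Scope ring_scope.

Definition unit_sphere (R : realType) (X : normedModType R) : set X :=
  [set x | `|x| = 1].
Arguments unit_sphere {R} X.

(* Two linearly independent vectors exist; the library's dimension is only
   available for finite-dimensional spaces, whereas X may be of any dimension. *)
Definition dim_ge2 (R : realType) (X : lmodType R) : Prop :=
  exists u v : X, forall a b : R, a *: u + b *: v = 0 -> a = 0 /\ b = 0.
Arguments dim_ge2 {R} X.

(* [sup] is the real-valued supremum, with value 0 on sets that are empty or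
   unbounded above. Neither case arises when dim X >= 2: then there are unit
   vectors x, y with x - y a unit vector, and |x + y| <= 2 and
   |2x - y| = |x + (x - y)| <= 2 for all of them. *)
Definition H_const (R : realType) (X : normedModType R) : R :=
  sup [set r : R | exists x y : X,
    [/\ unit_sphere X x, unit_sphere X y, unit_sphere X (x - y) &
        r = Num.min `|x + y| `|2 *: x - y|]].
Arguments H_const {R} X.

Definition G_L (R : realType) (X : normedModType R) : R :=
  sup [set r : R | exists x y : X,
    [/\ `|x| = 1, `|y| = 1, `|x - y| = 1 &
        r = `|x + y| ^+ 2 + `|2 *: x - y| ^+ 2]].
Arguments G_L {R} X.

Definition uniformly_nonsquare (R : realType) (X : normedModType R) : Prop :=
  exists delta : R, 0 < delta < 1 /\
    forall x y : X, unit_sphere X x -> unit_sphere X y ->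
      `|x + y| / 2 <= 1 - delta \/ `|x - y| / 2 <= 1 - delta.
Arguments uniformly_nonsquare {R} X.

(* Main.v *)
Require Import Defs.
From HB Require Import structures.
From mathcomp Require Import all_boot all_order all_algebra.
From mathcomp Require Import all_classical all_reals all_analysis.
From mathcomp Require Import ring lra.

Import Order.TTheory GRing.Theory Num.Theory.
Import numFieldNormedType.Exports.

Local Open Scope classical_set_scope.
Local Open Scope ring_scope.

(** Both constants range over the triples of unit vectors x, y, x - y, and
    since 2x - y = x + (x - y), both norms |x + y| and |2x - y| are at most 2
    on them; so the suprema are genuine ones, bounded by 8 and 2.

    From G_L to H: if m is the smaller of the two norms then
    2 m^2 <= |x + y|^2 + |2x - y|^2 <= G_L, hence H <= sqrt (G_L / 2).

    From H to uniform non-squareness, by contraposition: if unit vectors x, y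
    satisfy |x + y|, |x - y| > 2 (1 - d), then |a x + b y| is nearly
    |a| + |b|, so x and y span almost a plane with the l1 norm.  In an exact
    l1 plane, the vector v = (x + y) / 2 satisfies |v| = |x - v| = 1 and
    |x + v| = |2x - v| = 2, which would make H equal to 2.  In the perturbed
    plane, [almost_square_witness] finds such a v by continuity: the radial
    projection onto the unit sphere of the segment from x to y starts at
    distance 0 from x and ends at distance greater than 1, so it meets the
    sphere of radius 1 about x.  The segment is itself within 2 d of the unit
    sphere ([norm_segment_ge]), so projecting it moves its points by at most
    2 d, and the estimates of the l1 plane persist up to 8 d. *)

Lemma norm_mul2B_le {R : realType} {X : normedModType R} {x y : X} :
  `|x| = 1 -> `|x - y| = 1 -> `|2 *: x - y| <= 2.
Proof.
move=> x1 xy1.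
have -> : 2 *: x - y = x + (x - y) by rewrite scaler_nat mulr2n addrA.
by rewrite (le_trans (ler_normD _ _)) // x1 xy1; lra.
Qed.

Lemma norm_add_unit_le {R : realType} {X : normedModType R} {x y : X} :
  `|x| = 1 -> `|y| = 1 -> `|x + y| <= 2.
Proof. by move=> x1 y1; rewrite (le_trans (ler_normD _ _)) // x1 y1; lra. Qed.

Lemma min_le_H_const {R : realType} {X : normedModType R} {x y : X} :
  `|x| = 1 -> `|y| = 1 -> `|x - y| = 1 ->
  Num.min `|x + y| `|2 *: x - y| <= H_const X.
Proof.
move=> x1 y1 xy1; apply: ub_le_sup; last by exists x, y.
exists 2 => _ [u [v [u1 v1 _ ->]]].
by rewrite ge_min norm_add_unit_le.
Qed.

Lemma sum_sqr_le_G_L {R : realType} {X : normedModType R} {x y : X} :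
  `|x| = 1 -> `|y| = 1 -> `|x - y| = 1 ->
  `|x + y| ^+ 2 + `|2 *: x - y| ^+ 2 <= G_L X.
Proof.
move=> x1 y1 xy1; apply: ub_le_sup; last by exists x, y.
exists 8 => _ [u [v [u1 v1 uv1 ->]]].
have p2 := norm_add_unit_le u1 v1.
have q2 := norm_mul2B_le u1 uv1.
have p0 := normr_ge0 (u + v); have q0 := normr_ge0 (2 *: u - v).
by nra.
Qed.

Lemma H_const_le_sqrt (R : realType) (X : normedModType R) :
  H_const X <= Num.sqrt (G_L X / 2).
Proof.
rewrite /H_const; set A := [set _ | _].
have [-> | /set0P[a Aa]] := eqVneq A set0; first by rewrite sup0 sqrtr_ge0.
apply: ge_sup; first by exists a.
move=> _ [x [y [x1 y1 xy1 ->]]].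
have := sum_sqr_le_G_L x1 y1 xy1.
set p := `|x + y|; set q := `|2 *: x - y| => pqG.
have m0 : 0 <= Num.min p q by rewrite le_min !normr_ge0.
have mp : Num.min p q <= p by rewrite ge_min lexx.
have mq : Num.min p q <= q by rewrite ge_min lexx orbT.
have mG : Num.min p q ^+ 2 <= G_L X / 2 by nra.
by rewrite -[leLHS]ger0_norm // -sqrtr_sqr ler_wsqrtr.
Qed.

(** With a >= b, split a x + b y = a (x + y) - (a - b) y: only the norm of the
    sum enters, and the loss is proportional to the larger coefficient. *)
Lemma norm_comb_ge {R : realType} {X : normedModType R} (d a b : R) {x y : X} :
  `|y| = 1 -> 2 * (1 - d) <= `|x + y| -> 0 <= a -> b <= a ->
  a + b - 2 * d * a <= `|a *: x + b *: y|.
Proof.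
move=> y1 xy a0 ba.
have -> : a *: x + b *: y = a *: (x + y) - (a - b) *: y.
  by rewrite scalerDr scalerBl opprB addrACA subrr addr0.
apply: le_trans (lerB_dist _ _).
rewrite !normrZ y1 mulr1 (ger0_norm a0) ger0_norm ?subr_ge0 //.
by nra.
Qed.

Lemma norm_segment_ge {R : realType} {X : normedModType R} {d t : R} {x y : X} :
  0 <= d -> `|x| = 1 -> `|y| = 1 -> 2 * (1 - d) <= `|x + y| -> 0 <= t <= 1 ->
  1 - 2 * d <= `|(1 - t) *: x + t *: y|.
Proof.
move=> d0 x1 y1 xy /andP[t0 t1].
have [th|th] := leP t (1 - t).
  have := norm_comb_ge d (1 - t) t y1 xy; rewrite subr_ge0 => /(_ t1 th).
  by nra.
rewrite [x + y]addrC in xy; rewrite [_ *: x + _]addrC.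
by have := norm_comb_ge d t (1 - t) x1 xy t0 (ltW th); nra.
Qed.

Lemma dist_normalize {R : realType} {X : normedModType R} {p : X} :
  `|p| != 0 -> `|p - `|p|^-1 *: p| = `| `|p| - 1|.
Proof.
move=> p0; rewrite -{1}[p]scale1r -scalerBl normrZ.
rewrite -[X in _ * X]normr_id -normrM mulrBl mul1r mulVf //.
Qed.

(** The bound d <= 1/4 keeps the segment from x to y away from 0, so that it can
    be normalized, and makes |x - y| exceed 1, as the intermediate value
    theorem requires.  The parameter t which that theorem provides need not be
    1/2; its lower bound [t_ge] suffices, because |x + v| is nearly 2 for every
    t in [0, 1] and |2x - v| is at least 1 + 2t up to 6 d. *)
Lemma almost_square_witness {R : realType} {X : normedModType R} {d : R}
    {x y : X} :
  0 <= d <= 4^-1 -> `|x| = 1 -> `|y| = 1 ->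
  2 * (1 - d) <= `|x + y| -> 2 * (1 - d) <= `|x - y| ->
  exists v : X, [/\ `|v| = 1, `|x - v| = 1,
    2 - 8 * d <= `|x + v| & 2 - 8 * d <= `|2 *: x - v|].
Proof.
move=> /andP[d0 d4] x1 y1 sxy dxy.
pose p t := (1 - t) *: x + t *: y.
pose n t := `|p t|^-1 *: p t.
have p_ge t : 0 <= t <= 1 -> 1 - 2 * d <= `|p t| by exact: norm_segment_ge.
have p_neq0 t : 0 <= t <= 1 -> `|p t| != 0.
  by move=> /p_ge pt; apply: lt0r_neq0; lra.
have p_cont : continuous p.
  move=> t; apply: cvgD; apply: cvgZr_tmp; last exact: cvg_id.
  by apply: cvgB; [exact: cvg_cst | exact: cvg_id].
have n_cont : {within `[0, 1], continuous (fun t => `|x - n t|)}.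
  apply: continuous_in_subspaceT => t; rewrite inE /= in_itv /= => t01.
  apply: cvg_norm; apply: cvgB; first exact: cvg_cst.
  apply: cvgZ; last exact: p_cont.
  by apply: cvgV; [exact: p_neq0 | apply: cvg_norm; exact: p_cont].
have n0 : n 0 = x by rewrite /n /p subr0 scale0r addr0 scale1r x1 invr1 scale1r.
have n1 : n 1 = y by rewrite /n /p subrr scale0r add0r scale1r y1 invr1 scale1r.
have [|t] := @IVT R (fun t => `|x - n t|) 0 1 1 ler01 n_cont.
  rewrite n0 n1 subrr normr0 ge_min ler01 /= le_max; apply/orP; right.
  by lra.
rewrite in_itv /= => t01 xn1.
have /andP[t0 t1] := t01.
have pt := p_ge t t01.
have pt1 : `|p t| <= 1.
  rewrite (le_trans (ler_normD _ _)) // !normrZ x1 y1 !mulr1.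
  by rewrite !ger0_norm ?subr_ge0 //; lra.
have pn : `|p t - n t| <= 2 * d.
  by rewrite /n dist_normalize ?p_neq0 // ler_norml; apply/andP; split; lra.
have near (u w : X) : u - w = p t - n t \/ u - w = n t - p t ->
    `|u| - 2 * d <= `|w|.
  move=> uw; have : `|u - w| <= 2 * d by case: uw => ->; rewrite // distrC.
  by have := lerB_dist u w; lra.
(* |x - p t| = t |x - y| <= 2 t is within 2 d of |x - v| = 1, so t is at least
   1/2 up to d. *)
have t_ge : 1 - 2 * d <= 2 * t.
  have : `|x - n t| - 2 * d <= `|x - p t|.
    by apply: near; left; rewrite opprB addrC addrA subrK.
  have -> : x - p t = t *: (x - y).
    by rewrite /p scalerBl scale1r scalerBr opprD opprB addrA subrKC.
  rewrite normrZ ger0_norm // xn1.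
  have : `|x - y| <= 2 by rewrite norm_add_unit_le // normrN.
  by nra.
exists (n t); split => //.
- by rewrite /n normrZ normfV normr_id mulVf ?p_neq0.
- have : `|x + p t| - 2 * d <= `|x + n t|.
    by apply: near; left; rewrite opprD addrACA subrr add0r.
  have -> : x + p t = (2 - t) *: x + t *: y.
    by rewrite /p addrA -{1}[x]scale1r -scalerDl; congr (_ *: _ + _); ring.
  have t2 : t <= 2 - t by lra.
  have := norm_comb_ge d (2 - t) t y1 sxy _ t2.
  by move=> /(_ ltac:(lra)); nra.
- have : `|2 *: x - p t| - 2 * d <= `|2 *: x - n t|.
    by apply: near; right; rewrite opprB addrC addrA subrK.
  have -> : 2 *: x - p t = (1 + t) *: x + t *: (- y).
    rewrite /p opprD addrA -scalerBl scalerN; congr (_ *: _ - _); ring.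
  have t2 : t <= 1 + t by lra.
  have Ny1 : `|- y| = 1 by rewrite normrN.
  by have := norm_comb_ge d (1 + t) t Ny1 dxy _ t2; move=> /(_ ltac:(lra)); nra.
Qed.

Theorem theorem3p12 (R : realType) (X : completeNormedModType R)
    (hdim : dim_ge2 X) :
  (G_L X < 8 -> H_const X < 2) /\ (H_const X < 2 -> uniformly_nonsquare X).
Proof.
split=> [G8 | H2].
  apply: le_lt_trans (H_const_le_sqrt _ X) _.
  have sqrt4 : Num.sqrt (2 ^+ 2) = 2 :> R by rewrite sqrtr_sqr ger0_norm.
  by rewrite -[ltRHS]sqrt4 ltr_sqrt; lra.
(* The bound 2 - 8 d of the witness must exceed H, i.e. d < (2 - H) / 8. *)
pose d : R := Num.min 4^-1 ((2 - H_const X) / 16).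
have d0 : 0 < d by rewrite lt_min; apply/andP; split; lra.
have d4 : d <= 4^-1 by rewrite ge_min lexx.
have dH : d <= (2 - H_const X) / 16 by rewrite ge_min lexx orbT.
exists d; split; first by apply/andP; split; lra.
move=> x y x1 y1.
have [|sxy] := leP (`|x + y| / 2) (1 - d); first by left.
have [|dxy] := leP (`|x - y| / 2) (1 - d); first by right.
have d01 : 0 <= d <= 4^-1 by rewrite d4 ltW.
have sxy' : 2 * (1 - d) <= `|x + y| by lra.
have dxy' : 2 * (1 - d) <= `|x - y| by lra.
have [v [v1 xv1 xv xxv]] := almost_square_witness d01 x1 y1 sxy' dxy'.
have := min_le_H_const x1 v1 xv1.
have : 2 - 8 * d <= Num.min `|x + v| `|2 *: x - v| by rewrite le_min xv.
by lra.
Qed.
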